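(* Let $\mathcal{S}=(\overline{x},\overline{i},\overline{c},I,T,P)$ be a safety specification. The procedure SatWin1 (described in the context), run on $\mathcal{S}$, returns the winning region $W(\overline{x})$ of $\mathcal{S}$, or $\mathsf{false}$ if the specification $\mathcal{S}$ is unrealizable.
   Context: **Safety specifications.** A safety specification is a tuple $\mathcal{S}=(\overline{x},\overline{i},\overline{c},I,T,P)$ where $\overline{x},\overline{i},\overline{c}$ are finite vectors of Boolean variables (state variables, uncontrollable inputs, controllable inputs), $I(\overline{x})$ (initial states) and $P(\overline{x})$ (safe states) are propositional formulas, and $T(\overline{x},\overline{i},\overline{c},\overline{x}')$ is a propositional formula (transition relation; $\overline{x}'$ is a next-state copy of $\overline{x}$) that is complete, $\forall\overline{x},\overline{i},\overline{c}\,\exists\overline{x}'.\,T(\overline{x},\overline{i},\overline{c},\overline{x}')$, and deterministic, $\forall\overline{x},\overline{i},\overline{c},\overline{x}'_1,\overline{x}'_2.\,(T(\overline{x},\overline{i},\overline{c},\overline{x}'_1)\wedge T(\overline{x},\overline{i},\overline{c},\overline{x}'_2))\rightarrow \overline{x}'_1=\overline{x}'_2$. A state is a complete assignment to $\overline{x}$; a formula over $\overline{x}$ is identified with the set of states satisfying it. **Games.** A play is an infinite sequence of states $\mathbf{x}_0,\mathbf{x}_1,\ldots$ with $\mathbf{x}_0\models I$ such that in each step $j$ the environment first picks an assignment $\mathbf{i}_j$ to $\overline{i}$, then the system picks an assignment $\mathbf{c}_j$ to $\overline{c}$, and $\mathbf{x}_{j+1}$ is the next state given by $T$. The system wins a play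 iff all its states satisfy $P$. A (memoryless) strategy for the system is a formula $S(\overline{x},\overline{i},\overline{c},\overline{x}')$ with $S\rightarrow T$ and $\forall\overline{x},\overline{i}\,\exists\overline{c},\overline{x}'.\,S$; it is winning if all plays following $S$ instead of $T$ are won by the system. The winning region $W(\overline{x})$ is the set of all states from which a winning strategy exists (i.e., such that, if plays started in that state, the system would have a strategy winning all of them). A system implementation is a function $f$ mapping assignments of $(\overline{x},\overline{i})$ to assignments of $\overline{c}$; it realizes $\mathcal{S}$ if all plays (starting in $I$) in which the system always picks $\mathbf{c}_j=f(\mathbf{x}_j,\mathbf{i}_j)$ visit only states in $P$. $\mathcal{S}$ is realizable if some system implementation realizes it, and unrealizable otherwise. **Cubes and cores.** A cube is a conjunction of literals, treated as a set of literals; complete assignments are identified with the corresponding cubes. If $\mathbf{d}$ is a cube and $H$ a formula with $\mathbf{d}\wedge H$ unsatisfiable, $\mathrm{MinCore}(\mathbf{d},H)$ denotes some subset-minimal sub-cube $\mathbf{d}'\subseteq\mathbf{d}$ such that $\mathbf{d}'\wedge H$ is unsatisfiable. **Procedure SatWin1.** All satisfiability checks are made by sound and complete oracles; whenever a satisfying assignment or minimal core is computed, any correct one may be returned; satisfying assignments are complete assignments to the named variables. Line numbers: - (2) If $I(\overline{x})\wedge\neg P(\overline{x})$ is satisfiable, return $\mathsf{false}$. - (3) $F(\overline{x}):=P(\overline{x})$, $U(\overline{x},\overline{i}):=\mathsf{true}$, $G(\overline{x}):=F(\overline{x})$, $\mathit{precise}:=\mathsf{true}$. - (4) Repeat forever: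 - (5) Check satisfiability of $F(\overline{x})\wedge U(\overline{x},\overline{i})\wedge T(\overline{x},\overline{i},\overline{c},\overline{x}')\wedge\neg G(\overline{x}')$. - (6) If unsatisfiable: (7) if $\mathit{precise}$, return $F(\overline{x})$; (8) otherwise set $U:=\mathsf{true}$, $G:=F$, $\mathit{precise}:=\mathsf{true}$. - (9) If satisfiable, let $\mathbf{x},\mathbf{i}$ be the values of $\overline{x},\overline{i}$ in a satisfying assignment. - (10) Check satisfiability of $F(\overline{x})\wedge\mathbf{x}\wedge\mathbf{i}\wedge T(\overline{x},\overline{i},\overline{c},\overline{x}')\wedge F(\overline{x}')$. - (11) If unsatisfiable: (12) $\mathbf{x}_g:=\mathrm{MinCore}(\mathbf{x},\;F(\overline{x})\wedge\mathbf{i}\wedge T(\overline{x},\overline{i},\overline{c},\overline{x}')\wedge F(\overline{x}'))$; (13) if $\mathbf{x}_g\wedge I(\overline{x})$ is satisfiable, return $\mathsf{false}$; (14) $F:=F\wedge\neg\mathbf{x}_g$, $\mathit{precise}:=\mathsf{false}$. - (15) If satisfiable, let $\mathbf{c}$ be the value of $\overline{c}$ in a satisfying assignment; (16) $U:=U\wedge\neg\,\mathrm{MinCore}(\mathbf{x}\wedge\mathbf{i},\;\mathbf{c}\wedge F(\overline{x})\wedge U(\overline{x},\overline{i})\wedge T(\overline{x},\overline{i},\overline{c},\overline{x}')\wedge\neg G(\overline{x}'))$. *)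

(* Defs.v *)
From mathcomp Require Import all_boot.
From Stdlib Require Export Relation_Operators.

Set Implicit Arguments.
Unset Strict Implicit.
Unset Printing Implicit Defensive.

Inductive form (V : Type) : Type :=
| Top
| Var of V
| Neg of form V
| And of form V & form V
| Or of form V & form V.

Arguments Top {V}.

Fixpoint holds (V : Type) (a : V -> bool) (f : form V) : bool :=
  match f with
  | Top => true
  | Var v => a v
  | Neg g => ~~ holds a g
  | And g h => holds a g && holds a h
  | Or g h => holds a g || holds a h
  end.

Fixpoint rename (V W : Type) (r : V -> W) (f : form V) : form W :=
  match f with
  | Top => Top
  | Var v => Var (r v)
  | Neg g => Neg (rename r g)
  | And g h => And (rename r g) (rename r h)
  | Or g h => Or (rename r g) (rename r h)
  end.

Definition conj (V : Type) (fs : seq (form V)) : form V := foldr (@And V) Top fs.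

Definition assignment (V : finType) := {ffun V -> bool}.

Definition satisfiable (V : finType) (f : form V) : bool :=
  [exists a : assignment V, holds a f].

Definition join (V W : finType) (a : assignment V) (b : assignment W) :
    assignment (V + W)%type :=
  [ffun u => match u with inl v => a v | inr w => b w end].

Definition restr (V W : finType) (r : V -> W) (a : assignment W) :
    assignment V :=
  [ffun v => a (r v)].

(* The literal [(v, true)] is [v]; the literal [(v, false)] is its negation. *)
Definition literal (V : finType) := (V * bool)%type.

Definition cube (V : finType) := {set literal V}.

Definition lit_form (V : finType) (l : literal V) : form V :=
  if l.2 then Var l.1 else Neg (Var l.1).

Definition cube_form (V : finType) (d : cube V) : form V :=
  conj [seq lit_form l | l <- enum d].

Definition cube_of (V : finType) (a : assignment V) : cube V :=
  [set l : literal V | a l.1 == l.2].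

(* [e] is a possible value of MinCore(d, H).  The cubes are over [V] and [H] is
   over the larger set of variables [W], [r] being the embedding.  The relation
   holds for no [e] when [d] and [H] are jointly satisfiable. *)
Definition min_core (V W : finType) (r : V -> W) (d : cube V) (H : form W)
    (e : cube V) : bool :=
  minset [pred e' : cube V |
            (e' \subset d)
            && ~~ satisfiable (And (rename r (cube_form e')) H)] e.

Section Variables.
Variables nx ni nc : nat.

Definition state := assignment 'I_nx.
Definition uinput := assignment 'I_ni.
Definition cinput := assignment 'I_nc.

Definition xivar : finType := ('I_nx + 'I_ni)%type.
(* All variables, in the order x, i, c, x'. *)
Definition tvar : finType := (xivar + 'I_nc + 'I_nx)%type.

Definition of_xi (v : xivar) : tvar := inl (inl v).
Definition of_x (v : 'I_nx) : tvar := of_xi (inl v).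
Definition of_i (v : 'I_ni) : tvar := of_xi (inr v).
Definition of_c (v : 'I_nc) : tvar := inl (inr v).
Definition of_x' (v : 'I_nx) : tvar := inr v.

Definition glue (x : state) (i : uinput) (c : cinput) (x' : state) :
    assignment tvar :=
  join (join (join x i) c) x'.

Record safety_spec := SafetySpec {
  init : form 'I_nx;
  trans : form tvar;
  safe : form 'I_nx;
  trans_complete : forall x i c, exists x', holds (glue x i c x') trans;
  trans_deterministic : forall x i c x1' x2',
    holds (glue x i c x1') trans -> holds (glue x i c x2') trans -> x1' = x2'
}.

End Variables.

Section Games.
Variables (nx ni nc : nat) (spec : safety_spec nx ni nc).

(* The state sequence [x] obeys the relation [R] (which is [trans spec] or a
   strategy) at every step, for some choices of both players' inputs. *)
Definition follows (R : form (tvar nx ni nc)) (x : nat -> state nx) : Prop :=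
  exists (i : nat -> uinput ni) (c : nat -> cinput nc),
    forall j, holds (glue (x j) (i j) (c j) (x j.+1)) R.

Definition won (x : nat -> state nx) : Prop := forall j, holds (x j) (safe spec).

Definition is_strategy (S : form (tvar nx ni nc)) : Prop :=
  (forall a : assignment (tvar nx ni nc), holds a S -> holds a (trans spec)) /\
  (forall (x : state nx) (i : uinput ni),
     exists (c : cinput nc) (x' : state nx), holds (glue x i c x') S).

Definition winning_region (s : state nx) : Prop :=
  exists S, is_strategy S /\
    forall x : nat -> state nx, x 0 = s -> follows S x -> won x.

Definition realizes (f : state nx -> uinput ni -> cinput nc) : Prop :=
  forall (x : nat -> state nx) (i : nat -> uinput ni),
    holds (x 0) (init spec) ->
    (forall j, holds (glue (x j) (i j) (f (x j) (i j)) (x j.+1)) (trans spec)) ->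
    won x.

Definition realizable : Prop := exists f, realizes f.

Inductive outcome : Type :=
| OFalse
| OFormula of form 'I_nx.

(* [Loop F U G precise] is the program state at the head of the loop body. *)
Inductive config : Type :=
| Start
| Loop (F : form 'I_nx) (U : form (xivar nx ni)) (G : form 'I_nx) (precise : bool)
| Return of outcome.

Local Notation T := (trans spec).
Local Notation cur := (rename (@of_x nx ni nc)).
Local Notation next := (rename (@of_x' nx ni nc)).
Local Notation inp := (rename (@of_i nx ni nc)).
Local Notation ctl := (rename (@of_c nx ni nc)).
Local Notation curinp := (rename (@of_xi nx ni nc)).

Definition escape_query (F : form 'I_nx) (U : form (xivar nx ni))
    (G : form 'I_nx) : form (tvar nx ni nc) :=
  conj [:: cur F; curinp U; T; Neg (next G)].

Definition stay_query (F : form 'I_nx) (x : state nx) (i : uinput ni) :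
    form (tvar nx ni nc) :=
  conj [:: cur F; cur (cube_form (cube_of x)); inp (cube_form (cube_of i));
           T; next F].

Definition lose_core (F : form 'I_nx) (x : state nx) (i : uinput ni)
    (xg : cube 'I_nx) : bool :=
  min_core (@of_x nx ni nc) (cube_of x)
    (conj [:: cur F; inp (cube_form (cube_of i)); T; next F]) xg.

Definition block_core (F : form 'I_nx) (U : form (xivar nx ni)) (G : form 'I_nx)
    (x : state nx) (i : uinput ni) (c : cinput nc) (d : cube (xivar nx ni)) : bool :=
  min_core (@of_xi nx ni nc) (cube_of (join x i))
    (conj [:: ctl (cube_form (cube_of c)); cur F; curinp U; T; Neg (next G)]) d.

(* One step from [Loop] is one complete iteration of the loop body.  Every
   choice of satisfying assignment and of minimal core gives a step. *)
Inductive step : config -> config -> Prop :=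
| StepInitUnsafe :
    satisfiable (And (init spec) (Neg (safe spec))) ->
    step Start (Return OFalse)
| StepInitialize :
    ~~ satisfiable (And (init spec) (Neg (safe spec))) ->
    step Start (Loop (safe spec) Top (safe spec) true)
| StepReturn F U G :
    ~~ satisfiable (escape_query F U G) ->
    step (Loop F U G true) (Return (OFormula F))
| StepReset F U G :
    ~~ satisfiable (escape_query F U G) ->
    step (Loop F U G false) (Loop F Top F true)
| StepLoseInit F U G precise (a : assignment (tvar nx ni nc)) xg :
    let x := restr (@of_x nx ni nc) a in
    let i := restr (@of_i nx ni nc) a in
    holds a (escape_query F U G) ->
    ~~ satisfiable (stay_query F x i) ->
    lose_core F x i xg ->
    satisfiable (And (cube_form xg) (init spec)) ->
    step (Loop F U G precise) (Return OFalse)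
| StepLose F U G precise (a : assignment (tvar nx ni nc)) xg :
    let x := restr (@of_x nx ni nc) a in
    let i := restr (@of_i nx ni nc) a in
    holds a (escape_query F U G) ->
    ~~ satisfiable (stay_query F x i) ->
    lose_core F x i xg ->
    ~~ satisfiable (And (cube_form xg) (init spec)) ->
    step (Loop F U G precise) (Loop (And F (Neg (cube_form xg))) U G false)
| StepBlock F U G precise (a b : assignment (tvar nx ni nc)) d :
    let x := restr (@of_x nx ni nc) a in
    let i := restr (@of_i nx ni nc) a in
    let c := restr (@of_c nx ni nc) b in
    holds a (escape_query F U G) ->
    holds b (stay_query F x i) ->
    block_core F U G x i c d ->
    step (Loop F U G precise) (Loop F (And U (Neg (cube_form d))) G precise).

Definition reachable (k : config) : Prop := clos_refl_trans config step Start k.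

End Games.

Arguments OFalse {nx}.
Arguments Start {nx ni}.
Arguments Return {nx ni} _.

(* Main.v *)
(** The loop keeps the invariant [W ⊆ F ⊆ P], [F ⊆ G] and [I ⊆ F]: a removed cube
    contains no winning state, since for some input [i] none of its states in [F]
    can be kept in [F], hence none can be kept in [W].  Moreover, every pair
    (x, i) outside [U] with x in [F] has a control leading into [G].  When the
    procedure returns [F] we have [F = G], so [F] is controlled invariant and
    therefore contained in [W].  Termination is lexicographic: a removal
    decreases |F|, a reset makes [precise] true, and blocking decreases |U|. *)
Require Import Defs.
From mathcomp Require Import all_boot.
From mathcomp Require Import zify.

Set Implicit Arguments.
Unset Strict Implicit.
Unset Printing Implicit Defensive.

(** * Semantics of formulas and cubes *)

Section Formulas.
Variable V : finType.

Lemma holds_conj (a : V -> bool) (fs : seq (form V)) :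
  holds a (conj fs) = all (holds a) fs.
Proof. by elim: fs => //= f fs ->. Qed.

Lemma holds_cube_form (a : assignment V) (d : cube V) :
  holds a (cube_form d) = (d \subset cube_of a).
Proof.
have litE l : holds a (lit_form l) = (l \in cube_of a).
  by rewrite inE /lit_form; case: l => v [] /=; [rewrite eqb_id | rewrite eqbF_neg].
rewrite /cube_form holds_conj all_map; apply/allP/subsetP => sda l.
  by move=> dl; rewrite -litE; apply: sda; rewrite mem_enum.
by rewrite mem_enum /= litE; apply: sda.
Qed.

Lemma cube_of_sub (a b : assignment V) :
  (cube_of a \subset cube_of b) = (a == b).
Proof.
apply/subsetP/eqP => [sab|-> //]; apply/ffunP => v.
by have := sab (v, a v); rewrite !inE /= eqxx => /(_ isT)/eqP.
Qed.

Lemma satisfiableP (f : form V) :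
  reflect (exists a : assignment V, holds a f) (satisfiable f).
Proof. exact: existsP. Qed.

(** Strategies have to be formulas, so a semantic condition is written in disjunctive normal form,
    one full cube per model; [Neg Top] is the empty disjunction. *)
Definition form_of (p : pred (assignment V)) : form V :=
  foldr (@Or V) (Neg Top) [seq cube_form (cube_of a) | a <- enum p].

Lemma holds_form_of (p : pred (assignment V)) (a : assignment V) :
  holds a (form_of p) = p a.
Proof.
have -> : p a = (a \in enum p) by rewrite mem_enum.
rewrite /form_of; elim: (enum p) => //= b s ->.
by rewrite holds_cube_form cube_of_sub in_cons eq_sym.
Qed.

Definition models (f : form V) : {set assignment V} :=
  [set a : assignment V | holds a f].

Lemma card_models_block (f g : form V) (a : assignment V) :
  holds a f -> holds a g -> #|models (And f (Neg g))| < #|models f|.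
Proof.
move=> fa ga; apply: proper_card; apply/properP; split.
  by apply/subsetP => b; rewrite !inE /= => /andP[].
by exists a; rewrite !inE //= fa ga.
Qed.

End Formulas.

(** * Minimal unsatisfiable cores *)

Section MinCore.
Variables (V W : finType) (r : V -> W) (H : form W).

Lemma holds_rename (a : assignment W) (f : form V) :
  holds a (rename r f) = holds (restr r a) f.
Proof.
elim: f => //= [v|f ->|f -> g ->|f -> g ->] //=.
by rewrite ffunE.
Qed.

Lemma min_core_sub (d e : cube V) : min_core r d H e -> e \subset d.
Proof. by move=> /minsetp/andP[]. Qed.

Lemma min_core_unsat (d e : cube V) (a : assignment W) :
  min_core r d H e -> holds (restr r a) (cube_form e) -> ~~ holds a H.
Proof.
move=> /minsetp/= /andP[_ /satisfiableP unsat] ae; apply/negP => aH.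
by apply: unsat; exists a; rewrite /= holds_rename ae.
Qed.

Lemma min_core_holds (x : assignment V) (e : cube V) :
  min_core r (cube_of x) H e -> holds x (cube_form e).
Proof. by rewrite holds_cube_form; apply: min_core_sub. Qed.

(** The full cube of [x] is satisfied by [x] alone, so it is itself an inconsistent sub-cube, and a
    minimal one lies below it. *)
Lemma min_core_exists (x : assignment V) :
  (forall a : assignment W, restr r a = x -> ~~ holds a H) ->
  exists e, min_core r (cube_of x) H e.
Proof.
move=> unsat; pose P := [pred e' : cube V | (e' \subset cube_of x)
  && ~~ satisfiable (And (rename r (cube_form e')) H)].
have Px : P (cube_of x).
  rewrite /P /= subxx; apply/satisfiableP => -[a /=].
  rewrite holds_rename holds_cube_form cube_of_sub eq_sym => /andP[/eqP xa].
  exact/negP/unsat.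
by have [e mine _] := minset_exists Px; exists e.
Qed.

End MinCore.

(** * Meaning of the queries on assignments split into x, i, c, x' *)

Section Queries.
Variables (nx ni nc : nat) (spec : safety_spec nx ni nc).
Implicit Types (x y s : state nx) (i : uinput ni) (c : cinput nc).
Implicit Types (F G : form 'I_nx) (U : form (xivar nx ni)).

Lemma restr_x_glue x i c y : restr (@of_x nx ni nc) (glue x i c y) = x.
Proof. by apply/ffunP => v; do !rewrite ffunE /=. Qed.

Lemma restr_i_glue x i c y : restr (@of_i nx ni nc) (glue x i c y) = i.
Proof. by apply/ffunP => v; do !rewrite ffunE /=. Qed.

Lemma restr_c_glue x i c y : restr (@of_c nx ni nc) (glue x i c y) = c.
Proof. by apply/ffunP => v; do !rewrite ffunE /=. Qed.

Lemma restr_x'_glue x i c y : restr (@of_x' nx ni nc) (glue x i c y) = y.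
Proof. by apply/ffunP => v; do !rewrite ffunE /=. Qed.

Lemma restr_xi_glue x i c y : restr (@of_xi nx ni nc) (glue x i c y) = join x i.
Proof. by apply/ffunP => v; do !rewrite ffunE /=; case: v => v /=; rewrite ?ffunE. Qed.

Definition restr_glueE :=
  (restr_x_glue, restr_i_glue, restr_c_glue, restr_x'_glue, restr_xi_glue).

Lemma glueP (a : assignment (tvar nx ni nc)) : exists x i c y, a = glue x i c y.
Proof.
exists (restr (@of_x nx ni nc) a), (restr (@of_i nx ni nc) a).
exists (restr (@of_c nx ni nc) a), (restr (@of_x' nx ni nc) a).
by apply/ffunP => -[[[v|v]|v]|v]; rewrite !ffunE.
Qed.

Lemma join_inj x i y j : join x i = join y j -> x = y /\ i = j.
Proof.
by move=> /ffunP e; split; apply/ffunP => v;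
  [have := e (inl v) | have := e (inr v)]; rewrite !ffunE.
Qed.

Lemma holds_escape_query F U G x i c y :
  holds (glue x i c y) (escape_query spec F U G) =
  [&& holds x F, holds (join x i) U, holds (glue x i c y) (trans spec)
    & ~~ holds y G].
Proof. by rewrite holds_conj /= !holds_rename !restr_glueE andbT. Qed.

Lemma holds_stay_query F s j x i c y :
  holds (glue x i c y) (stay_query spec F s j) =
  [&& holds x F, s == x, j == i, holds (glue x i c y) (trans spec) & holds y F].
Proof.
by rewrite holds_conj /= !holds_rename !restr_glueE !holds_cube_form
  !cube_of_sub andbT.
Qed.

(** The core drops literals of [x] but leaves [i] fixed, so one and the same input defeats every
    state of [F] in the cube. *)
Lemma lose_coreP F x i xg s c y :
  lose_core spec F x i xg -> holds s (cube_form xg) -> holds s F ->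
  holds (glue s i c y) (trans spec) -> ~~ holds y F.
Proof.
move=> core sxg sF tr; apply/negP => yF.
have := min_core_unsat (a := glue s i c y) core.
rewrite restr_x_glue => /(_ sxg).
by rewrite holds_conj /= !holds_rename !restr_glueE holds_cube_form subxx sF tr yF.
Qed.

Lemma lose_core_exists F x i :
  ~~ satisfiable (stay_query spec F x i) -> exists xg, lose_core spec F x i xg.
Proof.
move=> unsat; apply: min_core_exists => a; have [s [j [c [y ->]]]] := glueP a.
rewrite restr_x_glue => ->; apply: contra unsat => sat.
apply/satisfiableP; exists (glue x j c y); rewrite holds_stay_query eqxx.
by move: sat; rewrite holds_conj /= !holds_rename !restr_glueE holds_cube_form
  cube_of_sub andbT.
Qed.

Lemma block_coreP F U G x i c d s j y :
  block_core spec F U G x i c d -> holds (join s j) (cube_form d) ->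
  holds s F -> holds (join s j) U -> holds (glue s j c y) (trans spec) ->
  holds y G.
Proof.
move=> core sd sF sU tr; apply: contraT => yG.
have := min_core_unsat (a := glue s j c y) core.
rewrite restr_xi_glue => /(_ sd).
by rewrite holds_conj /= !holds_rename !restr_glueE holds_cube_form subxx sF sU tr yG.
Qed.

(** By determinism [y] is the only successor of [x] under [i] and [c], so no assignment extending
    these three escapes [G]. *)
Lemma block_core_exists F U G x i c y :
  holds (glue x i c y) (trans spec) -> holds y G ->
  exists d, block_core spec F U G x i c d.
Proof.
move=> tr yG; apply: min_core_exists => a; have [s [j [c' [y' ->]]]] := glueP a.
rewrite restr_xi_glue => /join_inj[-> ->].
rewrite holds_conj /= !holds_rename !restr_glueE holds_cube_form cube_of_sub.
rewrite andbT; apply/negP => /and5P[/eqP <- _ _ tr' /negP[]].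
by rewrite -(trans_deterministic tr tr').
Qed.

End Queries.

(** * Winning regions, controlled invariants and realizability *)

Section Games.
Variables (nx ni nc : nat) (spec : safety_spec nx ni nc).
Implicit Types (x y s : state nx) (i : uinput ni) (c : cinput nc).

Definition can_reach (A : state nx -> Prop) x i : Prop :=
  exists c y, holds (glue x i c y) (trans spec) /\ A y.

Lemma can_reach_mono (A B : state nx -> Prop) x i :
  (forall y, A y -> B y) -> can_reach A x i -> can_reach B x i.
Proof. by move=> AB [c [y [tr /AB By]]]; exists c, y. Qed.

Lemma follows_cons (S : form (tvar nx ni nc)) x i c (p : nat -> state nx) :
  holds (glue x i c (p 0)) S -> follows S p ->
  follows S (fun k => if k is j.+1 then p j else x).
Proof.
move=> Sx [ii [cc Sp]].
exists (fun k => if k is j.+1 then ii j else i).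
by exists (fun k => if k is j.+1 then cc j else c) => -[|j] /=.
Qed.

(** Winning constrains plays only, so it says something about [s] once a play from [s] exists;
    totality builds one under a constant input. *)
Lemma strategy_play (S : form (tvar nx ni nc)) s :
  is_strategy spec S -> exists p, p 0 = s /\ follows S p.
Proof.
case=> _ total; pose i0 : uinput ni := [ffun => false].
have ex x : exists cy : cinput nc * state nx, holds (glue x i0 cy.1 cy.2) S.
  by have [c [y Sxy]] := total x i0; exists (c, y).
pose p k := iter k (fun x => (xchoose (ex x)).2) s.
exists p; split=> //; exists (fun => i0), (fun k => (xchoose (ex (p k))).1) => k.
exact: xchooseP (ex (p k)).
Qed.

Lemma winning_safe s : winning_region spec s -> holds s (safe spec).
Proof.
case=> S [strat win]; have [p [p0 Sp]] := strategy_play s strat.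
by have := win p p0 Sp 0; rewrite p0.
Qed.

(** The strategy that wins from [s] also wins from the successor it allows: a play from there,
    prefixed with [s], is a play from [s]. *)
Lemma winning_reach s i :
  winning_region spec s -> can_reach (winning_region spec) s i.
Proof.
case=> S [strat win]; have [c [y Sy]] := strat.2 s i.
exists c, y; split; first exact: strat.1.
exists S; split=> // p p0 Sp k.
have Sq := @follows_cons S s i c p; rewrite p0 in Sq.
exact: (win _ _ (Sq Sy Sp) k.+1).
Qed.

Section ControlledInvariant.
Variable A : pred (state nx).
Hypothesis A_safe : forall x, A x -> holds x (safe spec).
Hypothesis A_inv : forall x i, A x -> can_reach A x i.

Lemma invariant_winning s : A s -> winning_region spec s.
Proof.
(* The strategy forbids leaving [A]; the implication permits every transition from outside [A],
   which keeps it total. *)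
move=> As; exists (And (trans spec) (form_of (fun a =>
  A (restr (@of_x nx ni nc) a) ==> A (restr (@of_x' nx ni nc) a)))).
split.
  split=> [a /= /andP[] //|x i].
  have [Ax|nAx] := boolP (A x).
    have [c [y [tr Ay]]] := A_inv i Ax.
    by exists c, y; rewrite /= tr holds_form_of !restr_glueE Ay implybT.
  pose c0 : cinput nc := [ffun => false].
  have [y tr] := trans_complete spec x i c0.
  by exists c0, y; rewrite /= tr holds_form_of !restr_glueE (negbTE nAx).
move=> p p0 [ii [cc Sp]]; have Ap k : A (p k).
  elim: k => [|k Ak]; first by rewrite p0.
  have /= /andP[_] := Sp k.
  by rewrite holds_form_of !restr_glueE Ak.
by move=> k; exact: A_safe.
Qed.

Lemma invariant_realizable :
  (forall x, holds x (init spec) -> A x) -> realizable spec.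
Proof.
move=> init_A.
pose good x i c := [exists y, holds (glue x i c y) (trans spec) && A y].
(* The default control is used only where no control leads into [A], hence never on states of
   [A]. *)
pose f x i := odflt [ffun => false] [pick c | good x i c].
exists f => p ii p0 tr; have Ap k : A (p k).
  elim: k => [|k Ak]; first exact: init_A.
  move: (tr k); rewrite /f; case: pickP => [c /existsP[y /andP[tr' Ay]]|none].
    by move=> /= /trans_deterministic/(_ tr') ->.
  have [c [y [tr' Ay]]] := A_inv (ii k) Ak.
  by have /existsP[] := none c; exists y; rewrite tr'.
by move=> k; exact: A_safe.
Qed.

End ControlledInvariant.

Lemma realizable_init_winning s :
  realizable spec -> holds s (init spec) -> winning_region spec s.
Proof.
case=> f real si; exists (And (trans spec) (form_of (fun a =>
  restr (@of_c nx ni nc) a ==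
  f (restr (@of_x nx ni nc) a) (restr (@of_i nx ni nc) a)))).
split.
  split=> [a /= /andP[] //|x i]; have [y tr] := trans_complete spec x i (f x i).
  by exists (f x i), y; rewrite /= tr holds_form_of !restr_glueE eqxx.
move=> p p0 [ii [cc Sp]]; apply: (real p ii); first by rewrite p0.
move=> k; have /= /andP[tr] := Sp k.
by rewrite holds_form_of !restr_glueE => /eqP <-.
Qed.

End Games.

(** * Loop invariant, progress and termination *)

Section Procedure.
Variables (nx ni nc : nat) (spec : safety_spec nx ni nc).
Implicit Types (x y s : state nx) (i : uinput ni) (c : cinput nc).
Implicit Types (F G : form 'I_nx) (U : form (xivar nx ni)).

(** [G] is the value of [F] at the last reset. Blocked pairs refer to [G], so their clause survives
    removals from [F]; when [precise] holds, [F] and [G] agree. *)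
Record loop_inv F U G (precise : bool) : Prop := LoopInv {
  init_F : forall x, holds x (init spec) -> holds x F;
  F_safe : forall x, holds x F -> holds x (safe spec);
  F_G : forall x, holds x F -> holds x G;
  winning_F : forall x, winning_region spec x -> holds x F;
  precise_G : precise -> forall x, holds x G -> holds x F;
  blocked_reach : forall x i,
    holds x F -> ~~ holds (join x i) U -> can_reach spec (fun y => holds y G) x i
}.

(** Being the winning region does not imply realizability, which is therefore recorded separately
    for a returned formula. *)
Definition config_inv (k : config nx ni) : Prop :=
  match k with
  | Start => True
  | Loop F U G precise => loop_inv F U G precise
  | Return OFalse => ~ realizable spec
  | Return (OFormula F) =>
      realizable spec /\ forall x, holds x F <-> winning_region spec x
  end.

Lemma lose_core_not_winning F U G precise x i xg s :
  loop_inv F U G precise -> lose_core spec F x i xg ->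
  holds s (cube_form xg) -> ~ winning_region spec s.
Proof.
move=> inv core sxg win.
have [c [y [tr /(winning_F inv) yF]]] := winning_reach i win.
by have := lose_coreP core sxg (winning_F inv win) tr; rewrite yF.
Qed.

Lemma loop_inv_return F U G :
  loop_inv F U G true -> ~~ satisfiable (escape_query spec F U G) ->
  config_inv (Return (OFormula F)).
Proof.
move=> inv unsat.
have F_inv x i : holds x F -> can_reach spec (fun y => holds y F) x i.
  move=> xF; apply: (can_reach_mono (precise_G inv isT)).
  have [xU|] := boolP (holds (join x i) U); last exact: blocked_reach inv x i xF.
  (* For a pair still in [U], unsatisfiability of the escape query sends every control into [G], so
     an arbitrary one serves. *)
  pose c0 : cinput nc := [ffun => false].
  have [y tr] := trans_complete spec x i c0; exists c0, y; split=> //.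
  apply: contraT => yG; case/satisfiableP: unsat.
  by exists (glue x i c0 y); rewrite holds_escape_query xF xU tr.
split; first exact: (invariant_realizable (F_safe inv) F_inv (init_F inv)).
by move=> x; split; [exact: (invariant_winning (F_safe inv) F_inv)
  | exact: winning_F inv x].
Qed.

Lemma loop_inv_lose F U G precise x i xg :
  loop_inv F U G precise -> lose_core spec F x i xg ->
  ~~ satisfiable (And (cube_form xg) (init spec)) ->
  loop_inv (And F (Neg (cube_form xg))) U G false.
Proof.
move=> inv core unsat; split=> //= s.
- move=> si; rewrite (init_F inv) //; apply: contra unsat => sxg.
  by apply/satisfiableP; exists s; rewrite /= sxg.
- by case/andP=> sF _; exact: F_safe inv s sF.
- by case/andP=> sF _; exact: F_G inv s sF.
- move=> win; rewrite (winning_F inv) //.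
  by apply/negP => sxg; exact: (lose_core_not_winning inv core sxg win).
- by move=> j /andP[sF _]; exact: blocked_reach inv s j sF.
Qed.

Lemma loop_inv_block F U G precise x i c d :
  loop_inv F U G precise -> block_core spec F U G x i c d ->
  loop_inv F (And U (Neg (cube_form d))) G precise.
Proof.
move=> inv core; case: (inv) => ? ? ? ? ? blocked; split=> // s j sF.
rewrite /= negb_and negbK.
(* A newly blocked pair lies in the core cube, where [c] leads into [G]; a pair blocked earlier
   keeps its control. *)
have [sU /= sd|sU _] := boolP (holds (join s j) U); last exact: blocked.
have [y tr] := trans_complete spec s j c.
by exists c, y; split; last exact: (block_coreP core sd sF sU tr).
Qed.

Lemma step_inv k k' : step spec k k' -> config_inv k -> config_inv k'.
Proof.
case=> {k k'} /=.
- case/satisfiableP=> s /= /andP[si /negP unsafe] _ real.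
  exact/unsafe/winning_safe/realizable_init_winning.
- move=> unsat _; split=> // s; last exact: winning_safe.
  move=> si; apply: contraT => ns; case/satisfiableP: unsat.
  by exists s; rewrite /= si.
- by move=> F U G unsat inv; exact: loop_inv_return inv unsat.
(* After a reset [U] is [Top] and [G] is [F], so the clauses on blocked pairs and on [precise] are
   trivial. *)
- by move=> F U G _ [? ? ? ? _ _]; split.
- move=> F U G precise a xg _ _ core /satisfiableP[s /= /andP[sxg si]] inv real.
  exact: (lose_core_not_winning inv core sxg (realizable_init_winning real si)).
- by move=> F U G precise a xg _ _ core unsat inv; exact: loop_inv_lose inv core unsat.
- by move=> F U G precise a b d _ _ core inv; exact: loop_inv_block inv core.
Qed.

Lemma reachable_inv k : reachable spec k -> config_inv k.
Proof.
rewrite /reachable => reach; have : config_inv Start by [].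
by elim: reach => {k} [k k' /step_inv|k|k1 k2 k3 _ IH1 _ IH2] //; auto.
Qed.

Lemma loop_progress F U G precise :
  loop_inv F U G precise -> exists k, step spec (Loop F U G precise) k.
Proof.
move=> inv; have [sat|unsat] := boolP (satisfiable (escape_query spec F U G)).
  have [a aq] := satisfiableP _ sat.
  set x := restr (@of_x nx ni nc) a; set i := restr (@of_i nx ni nc) a.
  have [stay|lose] := boolP (satisfiable (stay_query spec F x i)).
    have [b bq] := satisfiableP _ stay.
    have [d core] : exists d,
        block_core spec F U G x i (restr (@of_c nx ni nc) b) d.
      (* The stay query yields a successor in [F], hence in [G], as the existence of the core
         requires. *)
      have [s [j [c [y eb]]]] := glueP b; move: bq.
      rewrite eb holds_stay_query restr_c_glue => /and5P[_ /eqP-> /eqP-> tr yF].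
      exact: block_core_exists tr (F_G inv yF).
    by eexists; exact: StepBlock aq bq core.
  have [xg core] := lose_core_exists lose.
  have [linit|nlinit] := boolP (satisfiable (And (cube_form xg) (init spec))).
    by eexists; exact: StepLoseInit aq lose core linit.
  by eexists; exact: StepLose aq lose core nlinit.
by case: precise inv => _; eexists; [exact: StepReturn | exact: StepReset].
Qed.

(** [M] exceeds the number of models of any [U]. A state removed from [F] frees [2 * M], which pays
    for clearing [precise]; a reset frees [M], which pays for refilling [U]. *)
Definition rank (k : config nx ni) : nat :=
  let M := #|{: assignment (xivar nx ni)}|.+1 in
  match k with
  | Start => (#|{: state nx}| * 2 * M + M).+2
  | Loop F U G precise =>
      (#|models F| * 2 * M + (~~ precise) * M + #|models U|).+1
  | Return _ => 0
  end.

Lemma step_rank k k' : step spec k k' -> rank k' < rank k.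
Proof.
have leU U : #|models U| <= #|{: assignment (xivar nx ni)}| by exact: max_card.
case=> {k k'} //; rewrite /rank.
- move=> _; have := leU Top.
  have : #|models (safe spec)| <= #|{: state nx}| by exact: max_card.
  by nia.
- by move=> F U G _; have := leU Top; lia.
- move=> F U G precise a xg aq _ core _.
  have [s [j [c [y ea]]]] := glueP a; rewrite {}ea in aq core.
  move: aq; rewrite holds_escape_query restr_x_glue in core * => /and4P[sF _ _ _].
  (* The core is a sub-cube of the current state, so at least that state leaves [F]. *)
  have ltF : #|models (And F (Neg (cube_form xg)))| < #|models F|.
    exact: card_models_block sF (min_core_holds core).
  have := leU U; move: #|models U| #|{: assignment _}| ltF => u M.
  move: #|models F| #|models _| => m n; case: precise => /=; nia.
- move=> F U G precise a b d aq _ core.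
  have [s [j [c [y ea]]]] := glueP a; rewrite {}ea in aq core.
  move: aq; rewrite holds_escape_query => /and4P[_ sU _ _].
  rewrite restr_x_glue restr_i_glue in core.
  have ltU : #|models (And U (Neg (cube_form d)))| < #|models U|.
    exact: card_models_block sU (min_core_holds core).
  by lia.
Qed.

Lemma no_infinite_run (run : nat -> config nx ni) :
  ~ forall k, step spec (run k) (run k.+1).
Proof.
move=> steps; have bound k : rank (run k) + k <= rank (run 0).
  by elim: k => [|k IH]; [lia | have := step_rank (steps k); lia].
by have := bound (rank (run 0)).+1; lia.
Qed.

End Procedure.

Theorem theorem12 (nx ni nc : nat) (spec : safety_spec nx ni nc) :
  (* every run terminates *)
  (~ exists run : nat -> config nx ni,
       run 0 = Start /\ forall k : nat, step spec (run k) (run k.+1)) /\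
  (* no run gets stuck before returning *)
  (forall k : config nx ni, reachable spec k ->
     (exists r : outcome nx, k = Return r) \/
     (exists k' : config nx ni, step spec k k')) /\
  (* every returned result is the right one *)
  (forall r : outcome nx, reachable spec (Return r) ->
     (realizable spec ->
        exists F : form 'I_nx, r = OFormula F /\
          forall x : state nx, holds x F <-> winning_region spec x) /\
     (~ realizable spec -> r = OFalse)).
Proof.
split; first by case=> run [_ /no_infinite_run].
split=> [k /reachable_inv|r /reachable_inv].
  case: k => [_|F U G precise /= inv|r _]; last by left; exists r.
    right; have [unsafe|nunsafe] :=
      boolP (satisfiable (And (init spec) (Neg (safe spec)))).
      by eexists; exact: StepInitUnsafe.
    by eexists; exact: StepInitialize.
  by right; exact: loop_progress inv.
case: r => [nreal|F /= [real FW]]; first by split.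
by split=> // _; exists F.
Qed.
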